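(* Algorithm A with $m=n$ registers solves obstruction-free consensus among the $n$ anonymous processes, i.e., in every execution: (Validity) every decided value was proposed by some process; (Agreement) no two processes decide different values; (OB-termination) if there is a time after which a single process executes steps alone, that process decides; (SV-termination) if all processes propose the same value, every correct (non-crashed) process decides.
   Context: Quadruplets, lexicographic order: a quadruplet is $\langle rd,\mathit{lvl},\mathit{cfl},\mathit{val}\rangle$ with $rd\in\mathbb{N}$, $\mathit{lvl}\in\{\mathtt{down}<\mathtt{up}\}$, $\mathit{cfl}\in\{\mathtt{false}<\mathtt{true}\}$, $\mathit{val}$ in a totally ordered value set with a least default $\bot$; quadruplets are totally ordered lexicographically. For a nonempty finite set $T$ of quadruplets with lexicographic maximum $\langle r,\ell,c,v\rangle$, $\mathrm{sup}(T)=\langle r,\ell,\mathit{conflict}(T),v\rangle$ where $\mathit{conflict}(T)$ holds iff some element of $T$ of round $r$ has conflict field $\mathtt{true}$, or the elements of $T$ of round $r$ carry at least two distinct values. Model and Algorithm A: $n$ anonymous asynchronous processes (identical code, no identities; any number may crash, a crashed process takes no further steps) share an atomic snapshot object $\mathit{REG}[1..m]$ of multi-writer registers, each initially $\langle 0,\mathtt{down},\mathtt{false},\bot\rangle$, with atomic operations $\mathrm{snapshot}()$ (returns the whole array) and $\mathrm{write}(x,X)$; executions are interleavings of atomic steps. Each process proposes one value $v\neq\bot$ by invoking the following, and decides the value it returns: repeat forever: $\mathit{view}\leftarrow\mathrm{snapshot}()$; then (1) if all entries equal $\langle r,\mathtt{up},\mathtt{false},w\rangle$ with $r>0$, return $w$;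 (2) else if all entries equal $\langle r,\mathtt{down},\mathtt{false},w\rangle$ with $r>0$, write $\langle r+1,\mathtt{up},\mathtt{false},w\rangle$ into $\mathit{REG}[1]$; (3) else if all entries equal $\langle r,\ell,\mathtt{true},w\rangle$ with $r>0$, write $\langle r+1,\mathtt{down},\mathtt{false},w\rangle$ into $\mathit{REG}[1]$; (4) otherwise compute $S=\mathrm{sup}(\{\mathit{view}[1],\dots,\mathit{view}[m],\langle 1,\mathtt{down},\mathtt{false},v\rangle\})$, let $x$ be the smallest index with $\mathit{view}[x]\neq S$, and write $S$ into $\mathit{REG}[x]$. *)

(* Defs.v *)
From HB Require Import structures.
From mathcomp Require Import all_boot all_order.
Set Implicit Arguments. Unset Strict Implicit. Unset Printing Implicit Defensive.
Import Order.TTheory.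

Section AlgA.
Context {disp : Order.disp_t} {V : orderType disp}.

Definition down : bool := false.
Definition up : bool := true.

Record quad := Quad { rd : nat; lvl : bool; cfl : bool; qval : V }.

Definition quad_eqb (a b : quad) : bool :=
  [&& rd a == rd b, lvl a == lvl b, cfl a == cfl b & qval a == qval b].

Definition quad_le (a b : quad) : bool :=
  (rd a < rd b)%N ||
  ((rd a == rd b) &&
   ((~~ lvl a && lvl b) ||
    ((lvl a == lvl b) &&
     ((~~ cfl a && cfl b) ||
      ((cfl a == cfl b) && (qval a <= qval b)%O))))).

Definition qmax (a b : quad) : quad := if quad_le a b then b else a.

Definition sup (t0 : quad) (T : seq quad) : quad :=
  let L := t0 :: T in
  let mx := foldl qmax t0 T in
  let r := rd mx in
  let conflict :=
    has (fun t => (rd t == r) && cfl t) L ||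
    has (fun t => has (fun t' => [&& rd t == r, rd t' == r & qval t != qval t']) L) L in
  Quad r (lvl mx) conflict (qval mx).

Definition allsame (view : seq quad) : option quad :=
  match view with
  | [::] => None
  | q :: rest => if all (quad_eqb q) rest then Some q else None
  end.

(* Local state of a process: about to take a snapshot, about to write
   quadruplet q into register with (0-based) index x, or decided w. *)
Inductive pstate :=
| Idle
| Pending of nat & quad
| Decided of V.

(* The local computation following a snapshot returning view, for a process
   proposing v.  Register REG[1] is index 0. *)
Definition after_snapshot (v : V) (view : seq quad) : pstate :=
  match allsame view with
  | Some q =>
      if (0 < rd q)%N && (lvl q == up) && ~~ cfl q then Decided (qval q)
      else if (0 < rd q)%N && (lvl q == down) && ~~ cfl q then
        Pending 0 (Quad (rd q).+1 up false (qval q))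
      else if (0 < rd q)%N && cfl q then
        Pending 0 (Quad (rd q).+1 down false (qval q))
      else
        let S := sup (Quad 1 down false v) view in
        Pending (find (fun e => ~~ quad_eqb e S) view) S
  | None =>
      let S := sup (Quad 1 down false v) view in
      Pending (find (fun e => ~~ quad_eqb e S) view) S
  end.

Record config (n : nat) := Config { mem : seq quad; loc : 'I_n -> pstate }.

Definition step (n : nat) (p : 'I_n) (v : V) (c : config n) : config n :=
  let upd (s : pstate) := fun i : 'I_n => if i == p then s else loc c i in
  match loc c p with
  | Idle => Config (mem c) (upd (after_snapshot v (mem c)))
  | Pending x q => Config (set_nth q (mem c) x q) (upd Idle)
  | Decided _ => c
  end.

Fixpoint run (bot : V) (m n : nat) (prop : 'I_n -> V) (sched : nat -> option 'I_n)
    (t : nat) : config n :=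
  match t with
  | 0 => Config (nseq m (Quad 0 down false bot)) (fun _ => Idle)
  | t'.+1 =>
      let c := run bot m prop sched t' in
      match sched t' with
      | None => c
      | Some p => step p (prop p) c
      end
  end.

Definition decides_at (bot : V) (m n : nat) (prop : 'I_n -> V)
    (sched : nat -> option 'I_n) (t : nat) (p : 'I_n) (w : V) : Prop :=
  loc (run bot m prop sched t) p = Decided w.

(* p is correct (never crashes): it takes infinitely many steps. *)
Definition correct (n : nat) (sched : nat -> option 'I_n) (p : 'I_n) : Prop :=
  forall t, exists t', (t <= t')%N /\ sched t' = Some p.

End AlgA.

(* Main.v *)
(** The key fact is a covering argument. When a process snapshots a full view, i.e. [n]
    copies of one quadruplet [Z], at most [n - 1] other processes have a pending write, so
    these writes cannot erase all [n] copies. Being "good for [Z]" (larger round, or same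
    round and at least the same level, with either a conflict or the same value and no
    conflict) is inherited by every quadruplet computed from a view with a good entry.
    Hence every later full view is good for [Z].

    A quadruplet of level [up] in round [r + 1] comes from a full view
    [(r, down, false, w)], so all [up] quadruplets of a round have the same value. If
    [(r, up, false, w)] is ever a full view, then any quadruplet of a larger round has
    value [w], since the first one comes from a full view of round [r] that is either
    earlier, and then [(r, up, false, w)] is good for it, or later, and then of level [up].
    Agreement follows.

    A process running alone fills the array with the current supremum; each filling without
    decision moves from a conflict to [down] and from [down] to [up]. When only [v] is
    proposed, only three quadruplets ever occur, and a potential decreases whenever the
    memory changes; once the memory is constant, every process taking steps decides. *)

Require Import Defs.
From HB Require Import structures.
From mathcomp Require Import all_boot all_order zify.
Set Implicit Arguments. Unset Strict Implicit. Unset Printing Implicit Defensive.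
Import Order.TTheory.

(* The library's [mem] (predicates) shadows the field of [config]. *)
Local Notation regs := Defs.mem.

Section Quads.
Context {disp : Order.disp_t} {V : orderType disp}.
Implicit Types (q a b c Z X S : @quad disp V) (M : seq (@quad disp V)).

(** * The lexicographic order on quadruplets *)

Lemma quad_eqP : Equality.axiom (@quad_eqb disp V).
Proof.
move=> [r l c w] [r' l' c' w']; apply: (iffP and4P) => /=.
  by case=> /eqP-> /eqP-> /eqP-> /eqP->.
by case=> -> -> -> ->.
Qed.

HB.instance Definition _ := hasDecEq.Build (@quad disp V) quad_eqP.

(** An embedding into an iterated lexicographic product, from which [quad_le] inherits the laws of a
    total order. *)
Definition quad_key q : (nat *l (bool *l (bool *l V)))%type :=
  (rd q, (lvl q, (cfl q, qval q))).

Lemma quad_leE a b : quad_le a b = (quad_key a <= quad_key b)%O.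
Proof.
rewrite /quad_key !leEprodlexi /quad_le /= !leEnat !leEbool.
case: (ltngtP (rd a) (rd b)) => //= _.
by case: (lvl a); case: (lvl b) => //=; case: (cfl a); case: (cfl b).
Qed.

Lemma quad_key_inj : injective quad_key.
Proof. by move=> [r l c w] [r' l' c' w'] [-> -> -> ->]. Qed.

Lemma quad_le_refl : reflexive (@quad_le disp V).
Proof. by move=> a; rewrite quad_leE. Qed.

Lemma quad_le_trans : transitive (@quad_le disp V).
Proof. by move=> b a c; rewrite !quad_leE; apply: le_trans. Qed.

Lemma quad_le_anti a b : quad_le a b -> quad_le b a -> a = b.
Proof.
by rewrite !quad_leE => ab ba; apply/quad_key_inj/le_anti; rewrite ab.
Qed.

Lemma quad_le_total a b : quad_le a b || quad_le b a.
Proof. by rewrite !quad_leE le_total. Qed.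

Lemma quad_le_rd a b : quad_le a b -> rd a <= rd b.
Proof. by rewrite /quad_le; case: ltngtP. Qed.

Lemma quad_le_lvl a b : quad_le a b -> rd a = rd b -> lvl a -> lvl b.
Proof.
by move=> + eq_rd; rewrite /quad_le eq_rd ltnn eqxx /=; case: (lvl a); case: (lvl b).
Qed.

Lemma quad_ltn_le a b : rd a < rd b -> quad_le a b.
Proof. by rewrite /quad_le => ->. Qed.

(** * Suprema and their conflict field *)

Lemma qmax_foldlP a M : let mx := foldl (@qmax disp V) a M in
  mx \in a :: M /\ forall e, e \in a :: M -> quad_le e mx.
Proof.
elim: M a => [|b M IH] a /=.
  by split=> [|e]; rewrite inE // => /eqP->; apply: quad_le_refl.
have [mx_in mx_ub] := IH (qmax a b).
have [a_le b_le] : quad_le a (qmax a b) /\ quad_le b (qmax a b).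
  rewrite /qmax; case: ifP => [ab|]; first by rewrite quad_le_refl.
  by have := quad_le_total a b => /[swap] -> /= ->; rewrite quad_le_refl.
have {}mx_ub0 := mx_ub _ (mem_head _ _); split=> [|e].
  move: mx_in; rewrite !inE => /orP[/eqP->|->]; last by rewrite !orbT.
  by rewrite /qmax; case: ifP; rewrite eqxx ?orbT.
rewrite !inE => /or3P[/eqP->|/eqP->|eM]; first exact: quad_le_trans mx_ub0.
  exact: quad_le_trans mx_ub0.
by apply: mx_ub; rewrite inE eM orbT.
Qed.

Lemma sup_maxP a M : exists mx, [/\ mx \in a :: M,
  forall e, e \in a :: M -> quad_le e mx,
  rd (sup a M) = rd mx, lvl (sup a M) = lvl mx & qval (sup a M) = qval mx].
Proof. by have [] := qmax_foldlP a M; exists (foldl (@qmax disp V) a M). Qed.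

Lemma sup_rd_ge a M e : e \in a :: M -> rd e <= rd (sup a M).
Proof. by move=> eM; have [mx [_ /(_ _ eM) /quad_le_rd ? ->]] := sup_maxP a M. Qed.

Lemma cfl_sup a M (r := rd (sup a M)) :
  cfl (sup a M) = has (fun t => (rd t == r) && cfl t) (a :: M) ||
    has (fun t => has (fun t' => [&& rd t == r, rd t' == r & qval t != qval t'])
                    (a :: M)) (a :: M).
Proof. by []. Qed.

Lemma sup_cflF a M : cfl (sup a M) = false ->
  forall e, e \in a :: M -> rd e = rd (sup a M) ->
  cfl e = false /\ qval e = qval (sup a M).
Proof.
have [mx [mx_in _ rdS _ valS]] := sup_maxP a M.
rewrite cfl_sup rdS valS => /negbT; rewrite negb_or => /andP[/hasPn nocf /hasPn noval] e eM rde; split.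
  by have := nocf e eM; rewrite rde eqxx => /negbTE.
have /hasPn/(_ mx mx_in) := noval e eM; by rewrite rde !eqxx /= negbK => /eqP.
Qed.

Lemma sup_cfl_eqF a M w :
  (forall e, e \in a :: M -> rd e = rd (sup a M) -> cfl e = false /\ qval e = w) ->
  cfl (sup a M) = false.
Proof.
move=> same; rewrite cfl_sup.
apply/norP; split; apply/hasPn => e /same eP.
  by apply/andP=> -[/eqP/eP[->]].
apply/hasPn=> e' /same eP'; apply/and3P=> -[/eqP/eP[_ ->] /eqP/eP'[_ ->]].
by rewrite eqxx.
Qed.

(** Recomputing the conflict field can only raise it above that of the maximum, because a
    conflict-free supremum has a conflict-free maximum. *)
Lemma sup_max_le a M e : e \in a :: M -> quad_le e (sup a M).
Proof.
have [mx [mx_in ub]] := sup_maxP a M.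
move: (sup a M) (@sup_cflF a M) => S Sf rdS lS vS eM.
apply: quad_le_trans (ub _ eM) _; rewrite /quad_le rdS lS vS ltnn !eqxx lexx /=.
have -> : ~~ lvl mx && lvl mx = false by case: (lvl mx).
case cS: (cfl S); first by case: (cfl mx).
by have [->] := Sf cS mx mx_in (esym rdS).
Qed.

(** Evaluates [sup] from a candidate: a conflicting [S] is its own witness of conflict, and
    otherwise the last hypothesis excludes both sources of conflict. *)
Lemma sup_unique a M S : S \in a :: M ->
  (forall e, e \in a :: M -> quad_le e S) ->
  (~~ cfl S -> forall e, e \in a :: M -> rd e = rd S -> cfl e = false /\ qval e = qval S) ->
  sup a M = S.
Proof.
move=> Sin ub same; have [mx [mx_in mub rdS lS vS]] := sup_maxP a M.
have mxS : mx = S by apply: quad_le_anti; [apply: ub | apply: mub].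
have cS : cfl (sup a M) = cfl S.
  apply/idP/idP=> [|cS].
    by apply: contraLR => /same sm; rewrite (@sup_cfl_eqF _ _ (qval S)) // rdS mxS.
  apply/negPn/negP => /negbTE /sup_cflF/(_ S Sin).
  by rewrite rdS mxS cS => /(_ erefl)[].
by move: rdS lS vS cS; rewrite mxS; case: (sup a M) (S) => r l c w [r' l' c' w'] /= -> -> -> ->.
Qed.

(** * Full views and the computation after a snapshot *)

Lemma allsameP M q : reflect (0 < size M /\ M = nseq (size M) q) (allsame M == Some q).
Proof.
case: M => [|e M] /=; first by apply: (iffP eqP) => -[].
case: ifP => [/allP alle | nall]; last first.
  apply: (iffP eqP) => // -[_ [eq_e eqM]]; move/negP: nall; case.
  by rewrite eqM eq_e all_nseq; apply/orP; right; apply/quad_eqP.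
have -> : M = nseq (size M) e.
  by apply/all_pred1P/allP=> x /alle /quad_eqP ->; apply: eqxx.
by rewrite size_nseq; apply: (iffP eqP) => [[->]|[_ [->]]].
Qed.

Lemma allsame_mem M q : allsame M = Some q -> q \in M.
Proof. by move/eqP/allsameP=> [? ->]; rewrite mem_nseq eqxx andbT. Qed.

Variant snapshot_spec (v : V) M : @pstate disp V -> Type :=
| SnapDecide r w of allsame M = Some (Quad r up false w) & 0 < r :
    snapshot_spec v M (Decided w)
| SnapUp r w of allsame M = Some (Quad r down false w) & 0 < r :
    snapshot_spec v M (Pending 0 (Quad r.+1 up false w))
| SnapConflict r l w of allsame M = Some (Quad r l true w) & 0 < r :
    snapshot_spec v M (Pending 0 (Quad r.+1 down false w))
| SnapSup S of (forall q, allsame M = Some q -> rd q = 0)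
    & S = sup (Quad 1 down false v) M :
    snapshot_spec v M (Pending (find (predC1 S) M) S).

Lemma snapshotP v M : snapshot_spec v M (after_snapshot v M).
Proof.
rewrite /after_snapshot; case eqM: (allsame M) => [[r l c w]|] /=; last first.
  by apply: SnapSup => // q; rewrite eqM.
have [r0|r_gt0] /= := posnP r.
  by apply: SnapSup => // q; rewrite eqM => -[<-].
by case: l c eqM => -[] /= ?; [apply: SnapConflict | apply: SnapDecide
  | apply: SnapConflict | apply: SnapUp]; eassumption.
Qed.

Lemma sup_rd_gt0 v M : 0 < rd (sup (Quad 1 down false v) M).
Proof. by apply: leq_trans (sup_rd_ge (mem_head _ _)). Qed.

Lemma snapshot_changes v M x S : 0 < size M ->
  after_snapshot v M = Pending x S -> x < size M /\ nth S M x != S.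
Proof.
move=> M_gt0; case: snapshotP => //.
- by move=> r w /eqP/allsameP[_ ->] _ [<- <-]; rewrite nth_nseq size_nseq M_gt0; split=> //; apply/eqP=> -[].
- by move=> r l w /eqP/allsameP[_ ->] _ [<- <-]; rewrite nth_nseq size_nseq M_gt0; split=> //; apply/eqP=> -[]; lia.
move=> {}S' nfull eqS [<- <-].
have hasS : has (predC1 S') M.
  (* If every entry were [S'], the view would be full, and of positive round since the proposal has
     round 1; this contradicts [nfull]. *)
  apply/negPn/negP; rewrite -all_predC => allS.
  have /nfull : allsame M = Some S'.
    apply/eqP/allsameP; split=> //; apply/all_pred1P; apply: sub_all allS => e /=.
    by rewrite negbK.
  by rewrite eqS; have := sup_rd_gt0 v M => /[swap] ->.
by rewrite -has_find hasS; split=> //; apply: (nth_find S' hasS).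
Qed.


Lemma mem_set_nth M x q e : e \in set_nth q M x q -> e = q \/ e \in M.
Proof.
rewrite set_nthE; case: ifP => _; rewrite mem_cat => /orP[].
- by move/mem_take; right.
- by rewrite inE => /orP[/eqP|/mem_drop]; [left | right].
- by right.
by rewrite -cat_nseq mem_cat mem_nseq inE => /orP[/andP[_]|] /eqP; left.
Qed.

(* [good Z X]: [X] may coexist with an earlier full view [Z] without forgetting it.
   This is the property that survives taking [sup] with arbitrary stale quadruplets. *)
Definition good Z X : bool :=
  (rd Z < rd X) ||
  [&& rd Z == rd X, lvl Z ==> lvl X & cfl X || (~~ cfl Z && (qval X == qval Z))].

Lemma good_refl Z : good Z Z.
Proof. by rewrite /good !eqxx implybb; case: (cfl Z); rewrite orbT. Qed.

Lemma good_rd_ge Z X : good Z X -> rd Z <= rd X.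
Proof. by case/orP=> [/ltnW//|/and3P[/eqP->]]. Qed.

Lemma good_rd_eq Z X : good Z X -> rd Z = rd X ->
  (lvl Z -> lvl X) /\ (cfl X = false -> cfl Z = false /\ qval X = qval Z).
Proof.
move=> + eq_rd; rewrite /good eq_rd ltnn eqxx /= => /andP[/implyP lZX cX]; split=> // nc.
by move: cX; rewrite nc => /andP[/negbTE-> /eqP->].
Qed.

(** [SnapUp] and [SnapConflict] raise the round. A supremum that stays in the round of [Z] has [X]
    in its top round: its level is then at least that of [X], and without conflict it shares the
    value of [X]. *)
Lemma good_snapshot Z X v M x q : X \in M -> good Z X ->
  after_snapshot v M = Pending x q -> good Z q.
Proof.
move=> XM gX; case: snapshotP => //.
- move=> r w /eqP/allsameP[_ eqM] _ [_ <-].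
  by move: XM gX; rewrite eqM mem_nseq => /andP[_ /eqP->] /good_rd_ge /= le_r; rewrite /good /= ltnS le_r.
- move=> r l w /eqP/allsameP[_ eqM] _ [_ <-].
  by move: XM gX; rewrite eqM mem_nseq => /andP[_ /eqP->] /good_rd_ge /= le_r; rewrite /good /= ltnS le_r.
move=> S _ eqS [_ <-].
have XT : X \in Quad 1 down false v :: M by rewrite inE XM orbT.
have leXS := sup_max_le XT; have := @sup_cflF (Quad 1 down false v) M.
rewrite -eqS in leXS * => Sf.
rewrite /good; have := leq_trans (good_rd_ge gX) (quad_le_rd leXS).
rewrite leq_eqVlt => /orP[/eqP eqZS|->//].
have eqXS : rd X = rd S.
  by apply/eqP; rewrite eqn_leq quad_le_rd // -eqZS good_rd_ge.
have [lZX cZX] := good_rd_eq gX (etrans eqZS (esym eqXS)).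
rewrite eqZS ltnn eqxx /=; apply/andP; split.
  by apply/implyP=> /lZX; apply: quad_le_lvl leXS eqXS.
case cS: (cfl S) => //=; have [cX vX] := Sf cS X XT eqXS.
by have [-> <-] := cZX cX; rewrite vX eqxx.
Qed.

(** * Steps of the system and the covering argument *)

Section Steps.
Variable n : nat.
Implicit Types (C : @config disp V n) (p i : 'I_n).

Definition occurs C q := q \in regs C \/ exists i x, loc C i = Pending x q.

Lemma occurs_step p v C q : occurs (step p v C) q ->
  occurs C q \/ exists x, loc C p = Idle /\ after_snapshot v (regs C) = Pending x q.
Proof.
rewrite /step; case eqp: (loc C p) => [|x q'|w] /=; last by left.
- case=> [qM|[i [x]]] /=; first by left; left.
  by case: eqP => [_ ->|_ eqi]; [right; exists x | left; right; exists i, x].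
case=> [/mem_set_nth[->|qM]|[i [y]]] /=.
- by left; right; exists p, x.
- by left; left.
by case: eqP => // _ eqi; left; right; exists i, y.
Qed.

Definition wf C := size (regs C) = n /\ forall i x q, loc C i = Pending x q -> x < n.

Lemma wf_step p v C : wf C -> wf (step p v C).
Proof.
case=> szM ltx; rewrite /step; case eqp: (loc C p) => [|x q|w] //; split=> //=.
- move=> i x q; case: eqP => [_|_ /ltx//].
  by move/snapshot_changes; rewrite szM; case=> //; apply: leq_ltn_trans (ltn_ord p).
- by rewrite size_set_nth szM; apply/maxn_idPr; apply: ltx eqp.
by move=> i y q'; case: eqP => // _ /ltx.
Qed.

Definition pending_in (a : pred quad) C :=
  [pred i | if loc C i is Pending _ q then a q else false].

(* The covering argument: each bad pending write destroys at most one good register, so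
   some register is still good when all of them have been performed. *)
Definition covered Z C :=
  #|pending_in (predC (good Z)) C| < count (good Z) (regs C).

(** Strictness leaves a good register in every snapshot, so no snapshot creates a bad pending write.
    A bad write lowers the left side by one and the right side by at most one. *)
Lemma covered_step Z p v C : covered Z C -> covered Z (step p v C).
Proof.
rewrite /covered /step => cov; case eqp: (loc C p) => [|x q|w] //=.
  apply: leq_ltn_trans (cov); apply/subset_leq_card/subsetP=> i.
  rewrite !inE /=; case: eqP => [_|//].
  have /hasP[X XM gX] : has (good Z) (regs C) by rewrite has_count (leq_ltn_trans _ cov).
  by case eqs: after_snapshot => [||] //; rewrite /= (good_snapshot XM gX eqs).
rewrite count_set_nth; set C' := Config _ _.
have sub : pending_in (predC (good Z)) C' \subset [predD1 pending_in (predC (good Z)) C & p].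
  by apply/subsetP=> i; rewrite !inE /=; case: eqP.
apply: leq_ltn_trans (subset_leq_card sub) _; move: cov.
rewrite [X in X < _ -> _](cardD1 p) inE eqp /=; move: #|_| => k.
by case: (good Z q); case: (good Z _); case: (x < _) => /=; lia.
Qed.

Lemma covered_mem Z C : covered Z C -> exists2 X, X \in regs C & good Z X.
Proof. by move=> cov; apply/hasP; rewrite has_count (leq_ltn_trans _ cov). Qed.

Lemma covered_full Z p v C : wf C -> loc C p = Idle -> allsame (regs C) = Some Z ->
  covered Z (step p v C).
Proof.
move=> [szM _] eqp full; have ZM := allsame_mem full.
rewrite /covered /step eqp /=; move/eqP/allsameP: (full) => [_].
rewrite szM => eqM; have -> : count (good Z) (regs C) = n.
  by rewrite eqM count_nseq good_refl mul1n.
have n_gt0 : 0 < n by apply: leq_ltn_trans (ltn_ord p).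
(* Whatever [p] computes from this view is good, so only the other processes can hold bad writes,
   against [n] good registers. *)
have ltn1 : #|predC1 p| < n by rewrite cardC1 card_ord prednK.
apply: leq_ltn_trans ltn1; apply/subset_leq_card/subsetP=> i; rewrite !inE /=; case: eqP => // _.
by case eqs: after_snapshot => [||] //; rewrite /= (good_snapshot ZM (good_refl Z) eqs).
Qed.

End Steps.

(** * Potential of a solo execution *)

Definition target (v : V) M :=
  let S := sup (Quad 1 down false v) M in
  if allsame M is Some q then if 0 < rd q then q else S else S.

(* A process alone fills the array with [target]; each undecided full view lowers the stage. *)
Definition stage S : nat := if cfl S then 2 else ~~ lvl S.

(** The weight lets a drop of the stage outweigh any growth of the count. [target] singles out full
    views because [sup] also compares with the proposal: a full [(1, down, false, w)] with [w] other
    than [v] would yield a conflict. *)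
Definition solo_pot v M := stage (target v M) * (size M).+1 + count (predC1 (target v M)) M.

Lemma mem_set_nth_new M x q : q \in set_nth q M x q.
Proof.
rewrite set_nthE; case: ifP => _; rewrite mem_cat; first by rewrite mem_head orbT.
by rewrite -cat_nseq mem_cat mem_head !orbT.
Qed.

Lemma target_set_nth v M x S :
  (forall e, e \in Quad 1 down false v :: M -> quad_le e S) ->
  (~~ cfl S -> forall e, e \in Quad 1 down false v :: M ->
     rd e = rd S -> cfl e = false /\ qval e = qval S) ->
  target v (set_nth S M x S) = S.
Proof.
move=> ub same; set M' := set_nth _ _ _ _; have SM' : S \in M' := mem_set_nth_new M x S.
have sub e : e \in Quad 1 down false v :: M' -> e = S \/ e \in Quad 1 down false v :: M.
  rewrite inE => /orP[/eqP->|/mem_set_nth[->|eM]]; [right | by left | right].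
    exact: mem_head.
  by rewrite inE eM orbT.
have supS : sup (Quad 1 down false v) M' = S.
  apply: sup_unique => [|e /sub[->|/ub//]|nc e /sub[->|eM]].
  - by rewrite inE SM' orbT.
  - exact: quad_le_refl.
  - by split=> //; apply/negbTE.
  exact: same.
(* A full new memory can only be full of the [S] just written, so both branches of [target] give
   [S]. *)
rewrite /target supS; case full: (allsame M') => [q|//].
move/eqP/allsameP: full => [_ eqM']; move: SM'; rewrite eqM' mem_nseq => /andP[_ /eqP->].
by rewrite if_same.
Qed.

Lemma target_set_nth_high v M x S : cfl S = false -> 1 < rd S ->
  (forall e, e \in M -> rd e < rd S) -> target v (set_nth S M x S) = S.
Proof.
move=> nc gt1 ltM.
have lt_rd e : e \in Quad 1 down false v :: M -> rd e < rd S.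
  by rewrite inE => /orP[/eqP->|/ltM].
apply: target_set_nth => [e /lt_rd/quad_ltn_le//|_ e /lt_rd].
by move=> /[swap] ->; rewrite ltnn.
Qed.

Lemma solo_pot_decr v M x S : 0 < size M ->
  after_snapshot v M = Pending x S -> solo_pot v (set_nth S M x S) < solo_pot v M.
Proof.
move=> M_gt0 snap; have [ltx neqx] := snapshot_changes M_gt0 snap.
have szM' : size (set_nth S M x S) = size M by rewrite size_set_nth; apply/maxn_idPr.
have le_cnt : count (predC1 S) (set_nth S M x S) <= size M by rewrite -szM' count_size.
rewrite /solo_pot szM'; case: snapshotP snap => //.
- move=> r w full r0 [_ eqS]; move/eqP/allsameP: (full) => [_ eqM].
  have -> : target v M = Quad r down false w by rewrite /target full /= r0.
  have -> : target v (set_nth S M x S) = S.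
    by apply: target_set_nth_high; rewrite -eqS // => e; rewrite eqM mem_nseq => /andP[_ /eqP->].
  (* The stage falls from 1 to 0. *)
  by rewrite -[in stage S]eqS /stage /= mul0n mul1n ltn_addr.
- move=> r l w full r0 [_ eqS]; move/eqP/allsameP: (full) => [_ eqM].
  have -> : target v M = Quad r l true w by rewrite /target full /= r0.
  have -> : target v (set_nth S M x S) = S.
    by apply: target_set_nth_high; rewrite -eqS // => e; rewrite eqM mem_nseq => /andP[_ /eqP->].
  (* The stage falls from 2 to 1. *)
  have -> : stage S = 1 by rewrite -eqS.
  rewrite [stage _]/=; apply: leq_trans (leq_addr _ _).
  by rewrite mul1n mul2n -addnn ltn_add2l ltnS.
(* The target is [S] before and after the write, which repairs one register different from [S]. *)
move=> S' nfull supS [_ eqS]; rewrite {}eqS in supS *.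
have -> : target v M = S.
  by rewrite /target -supS; case: (allsame M) nfull => // q /(_ q erefl) ->.
have -> : target v (set_nth S M x S) = S.
  rewrite {}supS; apply: target_set_nth => [e|/negbTE]; first exact: sup_max_le.
  exact: sup_cflF.
rewrite ltn_add2l count_set_nth_ltn //= eqxx neqx /= addn0 subn1 ltn_predL.
rewrite -has_count; apply/hasP; exists (nth S M x) => //; exact: mem_nth.
Qed.

(** * Executions with a single proposed value *)

Section SameValue.
Variables (bot v : V) (n : nat).
Implicit Types (C : @config disp V n) (p i : 'I_n).
Local Notation q0 := (Quad 0 down false bot).
Local Notation q1 := (Quad 1 down false v).
Local Notation q2 := (Quad 2 up false v).

Lemma sv_neq : ((q1 == q0) = false) * ((q0 == q1) = false) * ((q2 == q0) = false) *
  ((q0 == q2) = false) * ((q2 == q1) = false) * ((q1 == q2) = false).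
Proof. by do !split; apply/eqP. Qed.

Lemma sv_snapshot M x S : 0 < size M -> {subset M <= [:: q0; q1; q2]} ->
  (q0 \in M -> q2 \notin M) ->
  after_snapshot v M = Pending x S -> S = if q0 \in M then q1 else q2.
Proof.
move=> M_gt0 sub no2; case: snapshotP => //.
- move=> r w full r0 [_ <-]; have := sub _ (allsame_mem full); rewrite !inE.
  case/or3P=> /eqP // -[er ew]; first by rewrite er in r0.
  move/eqP/allsameP: (full) => [_ ->].
  by rewrite er ew mem_nseq sv_neq andbF.
- by move=> r l w full r0 [_ <-]; have := sub _ (allsame_mem full); rewrite !inE => /or3P[] /eqP.
move=> _ nfull -> [_ <-]; case: ifP => M0.
  apply: sup_unique => [|e|_ e]; first exact: mem_head.
    rewrite inE => /orP[/eqP->|eM]; first exact: quad_le_refl.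
    have := sub _ eM; rewrite !inE => /or3P[] /eqP eqe.
    - by rewrite eqe; apply: quad_ltn_le.
    - by rewrite eqe; apply: quad_le_refl.
    by move: (no2 M0); rewrite -eqe eM.
  rewrite inE => /orP[/eqP->//|/sub]; rewrite !inE.
  by case/or3P=> /eqP->.
have M2 : q2 \in M.
  apply/negPn/negP=> no_2.
  have /nfull : allsame M = Some q1; last by [].
  apply/eqP/allsameP; split=> //; apply/all_pred1P/allP=> e eM /=.
  have := sub _ eM; rewrite !inE => /or3P[] // /eqP eqe.
    by rewrite -eqe eM in M0.
  by rewrite -eqe eM in no_2.
apply: sup_unique => [|e|_ e].
- by rewrite inE M2 orbT.
- rewrite inE => /orP[/eqP->|/sub]; first exact: quad_ltn_le.
  by rewrite !inE => /or3P[] /eqP->; [apply: quad_ltn_le | apply: quad_ltn_le | apply: quad_le_refl].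
by rewrite inE => /orP[/eqP->//|/sub]; rewrite !inE => /or3P[] /eqP->.
Qed.

Definition sv_inv C :=
  [/\ {subset regs C <= [:: q0; q1; q2]},
      forall i x q, loc C i = Pending x q -> q \in [:: q1; q2] &
      q0 \in regs C -> q2 \notin regs C /\ forall i x, loc C i <> Pending x q2].

(** No process ever writes [q0], and [q2] is computed only from a memory without [q0], so the two
    never coexist, even through a pending write. *)
Lemma sv_inv_step p C : wf C -> sv_inv C -> sv_inv (step p v C).
Proof.
move=> [szM ltx] [subM subP no2]; rewrite /step; case eqp: (loc C p) => [|x q|w] //.
  have M_gt0 : 0 < size (regs C) by rewrite szM; apply: leq_ltn_trans (ltn_ord p).
  have snap x q : after_snapshot v (regs C) = Pending x q ->
      q = if q0 \in regs C then q1 else q2.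
    by apply: sv_snapshot => // /no2[].
  split=> //= [i x q|M0].
    by case: eqP => [_ /snap->|_ /subP//]; case: ifP; rewrite !inE eqxx ?orbT.
  split=> [|i x]; first by case: (no2 M0).
  by case: eqP => [_ /snap|_]; [rewrite M0 | apply: (no2 M0).2].
have := subP _ _ _ eqp; rewrite !inE => q12; split=> /=.
- by move=> e /mem_set_nth[->|/subM//]; rewrite inE orbC !inE q12.
- by move=> i y e; case: eqP => // _ /subP.
case/mem_set_nth=> [eqq|M0].
  by move: q12; rewrite -eqq !sv_neq.
have [nM nP] := no2 M0; split=> [|i y]; last by case: eqP => // _; apply: nP.
apply/negP=> /mem_set_nth[eqq|]; last exact/negP.
by case: (nP p x); rewrite eqp eqq.
Qed.

(* While a register still holds [q0], [n] bounds the number of pending writes of [q1]; a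
   later write of [q1] may overwrite one [q2], hence the factor 2. *)
Definition sv_pot C :=
  count_mem q0 (regs C)
  + (if q0 \in regs C then n else #|pending_in (pred1 q1) C|).*2
  + count (predC1 q2) (regs C).

Lemma sv_pot_step p C : wf C -> sv_inv C ->
  sv_pot (step p v C) <= sv_pot C /\
  (regs (step p v C) != regs C -> sv_pot (step p v C) < sv_pot C).
Proof.
move=> [szM ltx] [subM subP no2]; rewrite /step; case eqp: (loc C p) => [|x q|w].
- rewrite eqxx; split=> //; rewrite /sv_pot /= leq_add2r leq_add2l leq_double.
  case: ifP => // M0; apply/subset_leq_card/subsetP=> i; rewrite !inE /=.
  case: eqP => [_|//]; case eqa: after_snapshot => [|x q|] //.
  (* Without [q0] in memory a snapshot can only produce [q2], so pending writes of [q1] do not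
     multiply. *)
  have M_gt0 : 0 < size (regs C) by rewrite szM; apply: leq_ltn_trans (ltn_ord p).
  have -> : q = q2.
    by have := sv_snapshot M_gt0 subM _ eqa; rewrite M0; apply.
  by rewrite /= sv_neq.
- have ltxM : x < size (regs C) by rewrite szM; apply: ltx eqp.
  set C' := Config _ _.
  have pend_le : #|pending_in (pred1 q1) C'| + (q == q1) <= #|pending_in (pred1 q1) C|.
    rewrite [leqRHS](cardD1 p) inE eqp /= addnC leq_add2l.
    by apply/subset_leq_card/subsetP=> i; rewrite !inE /=; case: eqP.
  have [eqx|neqx] := eqVneq (nth q (regs C) x) q.
    have eqM : regs C' = regs C.
      apply: (@eq_from_nth _ q) => [|i _]; first by rewrite size_set_nth; apply/maxn_idPr.
      by rewrite nth_set_nth /=; case: eqP => // ->.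
    rewrite eqM eqxx; split=> //; rewrite /sv_pot eqM leq_add2r leq_add2l leq_double.
    by case: ifP => // _; apply: leq_trans pend_le; apply: leq_addr.
  suff lt_pot : sv_pot C' < sv_pot C by split=> //; apply: ltnW.
  have pend_n : #|pending_in (pred1 q1) C'| <= n by rewrite -[n in _ <= n]card_ord max_card.
  have old_in := mem_nth q ltxM.
  have cnt (P : pred quad) :
      count P (set_nth q (regs C) x q) = count P (regs C) + P q - P (nth q (regs C) x).
    exact: count_set_nth_ltn.
  have cnt_gt0 (P : pred quad) : P (nth q (regs C) x) -> 0 < count P (regs C).
    by move=> Pold; rewrite -has_count; apply/hasP; exists (nth q (regs C) x).
  move: (nth q (regs C) x) neqx old_in cnt cnt_gt0 => old neqx old_in cnt cnt_gt0.
  have no0 : q0 \notin regs C -> q0 \notin set_nth q (regs C) x q.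
    apply: contra => /mem_set_nth[eqq|//].
    by have := subP _ _ _ eqp; rewrite -eqq !inE !sv_neq.
  have := subM _ old_in; have := subP _ _ _ eqp; rewrite !inE /sv_pot /= !cnt /=.
  move: (cnt_gt0 (pred1 q0)) (cnt_gt0 (predC1 q2)) pend_le pend_n => /=.
  case: (boolP (q0 \in regs C)) => [M0|/[dup] M0 /no0/negbTE->].
    have [no2M no2P] := no2 M0; move=> c0 c2 _ pend_n /orP[]/eqP eqq; last first.
      by case: (no2P p x); rewrite eqp eqq.
    (* A [q1] replaces a [q0]: the first term drops and the third is unchanged. If the last [q0]
       disappears, the middle term passes from [n] to a cardinal bounded by [n]. *)
    rewrite eqq in neqx *; case/or3P=> /eqP eqo.
    - move: c0 c2; rewrite eqo !sv_neq !eqxx /= => /(_ isT) + /(_ isT).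
      by case: ifP => _; lia.
    - by rewrite eqo eqxx in neqx.
    by rewrite -eqo old_in in no2M.
  move=> _ + pend_le _ q12 /or3P[]/eqP eqo.
  - by rewrite -eqo old_in in M0.
  - rewrite eqo in neqx *; move: q12; rewrite eq_sym (negbTE neqx) => /eqP eqq.
    by rewrite eqq !sv_neq eqxx /= in pend_le *; move/(_ isT); lia.
  (* A [q1] replaces a [q2]: the last term gains one, the doubled number of pending [q1] loses at
     least two. *)
  rewrite eqo in neqx *; move: q12; rewrite [_ == q2]eq_sym (negbTE neqx) orbF => /eqP eqq.
  by move=> _; rewrite eqq !sv_neq !eqxx /= in pend_le *; lia.
by rewrite eqxx.
Qed.

End SameValue.

(** * Runs with as many registers as processes, and their full views *)

Section Runs.
Variables (bot : V) (n : nat) (prop : 'I_n -> V) (sched : nat -> option 'I_n).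
Local Notation R := (run bot n prop sched).

Lemma runS t p : sched t = Some p -> R t.+1 = step p (prop p) (R t).
Proof. by move=> /= ->. Qed.

Lemma run_inv (P : config n -> Prop) t0 : P (R t0) ->
  (forall p v C, P C -> P (step p v C)) -> forall t, t0 <= t -> P (R t).
Proof.
move=> P0 PS; elim=> [|t IH]; first by rewrite leqn0 => /eqP <-.
rewrite leq_eqVlt => /orP[/eqP <-//|/IH Pt] /=.
by case: (sched t) => [p|//]; apply: PS.
Qed.

Lemma wf_run t : wf (R t).
Proof.
apply: (@run_inv (@wf n) 0) => //; last by move=> *; apply: wf_step.
by split; rewrite ?size_nseq.
Qed.

(** Writes only move a pending quadruplet into memory, so an invariant of occurring quadruplets is
    checked when one is computed. *)
Lemma occurs_run (P : nat -> quad -> Prop) :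
  (forall t, P t (Quad 0 down false bot)) ->
  (forall t q, P t q -> P t.+1 q) ->
  (forall t p x q, sched t = Some p -> loc (R t) p = Idle ->
     (forall e, occurs (R t) e -> P t e) ->
     after_snapshot (prop p) (regs (R t)) = Pending x q -> P t.+1 q) ->
  forall t q, occurs (R t) q -> P t q.
Proof.
move=> P0 Pmono PS; elim=> [|t IH] q.
  by case=> [|[i [x]]] //=; rewrite mem_nseq => /andP[_ /eqP->].
rewrite /=; case eqs: (sched t) => [p|]; last by move/IH/Pmono.
by case/occurs_step=> [/IH/Pmono//|[x [idle /PS]]]; apply.
Qed.

(** An idle process must actually take the snapshot: a full memory facing [n] pending writes could
    be erased entirely. *)
Definition fullview t Z := exists p,
  [/\ sched t = Some p, loc (R t) p = Idle & allsame (regs (R t)) = Some Z].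

Lemma fullview_occurs t Z : fullview t Z -> occurs (R t) Z.
Proof. by case=> p [_ _ /allsame_mem ZM]; left. Qed.

(** Covering by [Z] persists from the snapshot on, so the memory at [t] has an entry good for [Z],
    and every entry there is [Z']. *)
Lemma fullview_good s Z t Z' : fullview s Z -> s < t -> fullview t Z' -> good Z Z'.
Proof.
case=> p [eqs idle full] st [p' [_ _ full']].
have : covered Z (R t).
  apply: (@run_inv (covered Z) s.+1) => //; last by move=> *; apply: covered_step.
  by rewrite (runS eqs); apply: covered_full => //; apply: wf_run.
case/covered_mem=> X XM; move/eqP/allsameP: full' => [_ eqM].
by move: XM; rewrite eqM mem_nseq => /andP[_ /eqP->].
Qed.

Lemma fullview_uniq t Z Z' : fullview t Z -> fullview t Z' -> Z = Z'.
Proof. by case=> ? [_ _ e] [? [_ _]]; rewrite e => -[]. Qed.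

(** * Level [up], locked values and agreement *)

Lemma up_origin t q : occurs (R t) q -> lvl q ->
  exists s r, rd q = r.+1 /\ fullview s (Quad r down false (qval q)).
Proof.
move: t q; apply: occurs_run => // t p x q eqs idle IH; case: snapshotP => //.
- by move=> r w full _ [_ <-] _; exists t, r; split=> //; exists p.
- by move=> r l w _ _ [_ <-].
(* [sup] copies round, level and value from its maximum; at level [up] this is not the proposal,
   hence a register to which induction applies. *)
move=> S _ eqS [_ <-]; have [mx [mxT _]] := sup_maxP (Quad 1 down false (prop p)) (regs (R t)).
rewrite -eqS => -> -> ->; move: mxT; rewrite inE => /orP[/eqP->//|mxM].
by apply: IH; left.
Qed.

Lemma up_uniq t q t' q' : occurs (R t) q -> occurs (R t') q' -> lvl q -> lvl q' ->
  rd q = rd q' -> qval q = qval q'.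
Proof.
move=> /up_origin o /up_origin o' /o[s [r [-> f]]] /o'[s' [r' [-> f']]] [eqr]; subst r'.
case: (ltngtP s s') => [lt_ss|lt_ss|eqs].
- by have [_ /(_ erefl)[]] := good_rd_eq (fullview_good f lt_ss f') erefl.
- by have [_ /(_ erefl)[]] := good_rd_eq (fullview_good f' lt_ss f) erefl.
by move: f'; rewrite -eqs => /(fullview_uniq f)[].
Qed.

Lemma value_locked s r w : fullview s (Quad r up false w) -> 0 < r ->
  forall t q, occurs (R t) q -> r < rd q -> qval q = w.
Proof.
move=> f r_gt0; apply: occurs_run => // t p x q eqs idle IH; case: snapshotP => //.
- move=> r' w' full _ [_ <-] /=; rewrite ltnS leq_eqVlt => /orP[/eqP eqr|].
    have f' : fullview t (Quad r' down false w') by exists p.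
    (* A later full view of round [r] would have level [up], not [down]; an earlier one has value
       [w], since the conflict-free view at [s] is good for it. *)
    case: (ltngtP s t) => [st|ts|eqst].
    + by have [/(_ erefl)] := good_rd_eq (fullview_good f st f') eqr.
    + by have [_ /(_ erefl)[_ /= ->]] := good_rd_eq (fullview_good f' ts f) (esym eqr).
    by move: f'; rewrite -eqst => /(fullview_uniq f).
  by move/(IH (Quad r' down false w')); apply; left; apply: allsame_mem.
- move=> r' l w' full _ [_ <-] /=; rewrite ltnS leq_eqVlt => /orP[/eqP eqr|].
    have f' : fullview t (Quad r' l true w') by exists p.
    (* A later conflicting view of round [r] has level [up], hence value [w]; an earlier one would
       force a conflict on the view at [s]. *)
    case: (ltngtP s t) => [st|ts|eqst].
    + have [/(_ erefl) /= lup _] := good_rd_eq (fullview_good f st f') eqr.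
      by apply: (up_uniq (fullview_occurs f') (fullview_occurs f)); rewrite ?eqr.
    + by have [_ /(_ erefl)[]] := good_rd_eq (fullview_good f' ts f) (esym eqr).
    by move: f'; rewrite -eqst => /(fullview_uniq f).
  by move/(IH (Quad r' l true w')); apply; left; apply: allsame_mem.
move=> S _ eqS [_ <-]; have [mx [mxT _]] := sup_maxP (Quad 1 down false (prop p)) (regs (R t)).
rewrite -eqS => -> _ ->; move: mxT; rewrite inE => /orP[/eqP->/=|mxM].
  by rewrite ltnNge r_gt0.
by apply: IH; left.
Qed.

Lemma decided_fullview t p w : loc (R t) p = Decided w ->
  exists s r, 0 < r /\ fullview s (Quad r up false w).
Proof.
elim: t => //= t IH; case eqs: (sched t) => [p'|//]; rewrite /step.
case eqp: (loc (R t) p') => [|x q|w'] //=; last by case: eqP.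
case: eqP => [_|_ //]; case: snapshotP => // r w' full r_gt0 [<-].
by exists t, r; split=> //; exists p'.
Qed.

Lemma agreement t t' p p' w w' :
  loc (R t) p = Decided w -> loc (R t') p' = Decided w' -> w = w'.
Proof.
move=> /decided_fullview[s [r [r0 f]]] /decided_fullview[s' [r' [r0' f']]].
have [o o'] := (fullview_occurs f, fullview_occurs f').
case: (ltngtP r r') => [rr|rr|eqr].
- by have /= := value_locked f r0 o' rr.
- by have /= := value_locked f' r0' o rr.
by apply: (up_uniq o o'); rewrite ?eqr.
Qed.

(** The initial value [bot] is carried only in round 0, and suprema of positive round take their
    value from an entry of positive round. *)
Lemma occurs_proposed t q : occurs (R t) q -> 0 < rd q -> exists p, prop p = qval q.
Proof.
move: t q; apply: occurs_run => // t p x q eqs idle IH; case: snapshotP => //.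
- move=> r w full r0 [_ <-] _; apply: (IH (Quad r down false w)) => //.
  by left; apply: allsame_mem.
- move=> r l w full r0 [_ <-] _; apply: (IH (Quad r l true w)) => //.
  by left; apply: allsame_mem.
move=> S _ eqS [_ <-]; have [mx [mxT _]] := sup_maxP (Quad 1 down false (prop p)) (regs (R t)).
rewrite -eqS => -> _ ->; move: mxT; rewrite inE => /orP[/eqP->/= _|mxM]; first by exists p.
by apply: IH; left.
Qed.

Lemma validity t p w : loc (R t) p = Decided w -> exists p', prop p' = w.
Proof. by case/decided_fullview=> s [r [r0 /fullview_occurs/occurs_proposed]]; apply. Qed.

(** * Progress of correct processes and termination *)

Lemma next_step p t : correct sched p -> exists2 t', t <= t' &
  sched t' = Some p /\ forall s, t <= s < t' -> sched s != Some p.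
Proof.
move=> /(_ t)[u [tu eqs]].
have ex : exists s, (t <= s) && (sched s == Some p) by exists u; rewrite tu eqs eqxx.
case: (ex_minnP ex) => t' /andP[tt' /eqP eqt'] minP; exists t' => //; split=> // s /andP[ts st'].
by apply: contraL st' => eqp; rewrite -leqNgt minP // ts.
Qed.

Lemma loc_unchanged p t t' : t <= t' -> (forall s, t <= s < t' -> sched s != Some p) ->
  loc (R t') p = loc (R t) p.
Proof.
elim: t' => [|t' IH]; first by rewrite leqn0 => /eqP->.
rewrite leq_eqVlt => /orP[/eqP->//|tt'] nop.
rewrite -IH // => [|s /andP[ts st']]; last by apply: nop; rewrite ts ltnW.
have := nop t'; rewrite leqnn andbT => /(_ tt') /=; case: (sched t') => [p'|//] neq.
have {}neq : p == p' = false by apply: contraNF neq => /eqP->.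
by rewrite /step; case: (loc (R t') p') => //=; rewrite neq.
Qed.

Lemma next_step_loc p t : correct sched p -> exists2 t', t <= t' &
  [/\ sched t' = Some p, loc (R t') p = loc (R t) p &
      forall s, t <= s < t' -> sched s != Some p].
Proof.
move=> /(@next_step p t)[t' tt' [eqs nop]]; exists t' => //.
by split=> //; apply: loc_unchanged.
Qed.

Lemma next_idle p t : correct sched p ->
  exists2 t', t <= t' & loc (R t') p = Idle \/ exists w, loc (R t') p = Decided w.
Proof.
move=> cp; case eqp: (loc (R t) p) => [|x q|w].
- by exists t => //; left.
- have [u tu [eqs eql _]] := next_step_loc t cp; exists u.+1; first by rewrite ltnW.
  by left; rewrite (runS eqs) /step eql eqp /= eqxx.
by exists t => //; right; exists w.
Qed.


Lemma run_stutter t t' : t <= t' -> (forall s, t <= s < t' -> sched s = None) -> R t' = R t.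
Proof.
elim: t' => [|t' IH]; first by rewrite leqn0 => /eqP->.
rewrite leq_eqVlt => /orP[/eqP->//|tt'] none.
rewrite /= none ?IH // ?ltnSn ?andbT // => s /andP[ts st'].
by apply: none; rewrite ts ltnW.
Qed.

Lemma solo_decides p t k : correct sched p ->
  (forall s, t <= s -> sched s = Some p \/ sched s = None) ->
  loc (R t) p = Idle -> solo_pot (prop p) (regs (R t)) < k ->
  exists t' w, loc (R t') p = Decided w.
Proof.
move=> cp; elim: k t => // k IH t solo idle; rewrite ltnS => potk.
(* Until the next step of [p] all slots of the schedule are empty, so the configuration stands
   still. *)
have next s : t <= s -> exists2 u, s <= u & sched u = Some p /\ R u = R s.
  move=> ts; have [u su [eqs nop]] := next_step s cp; exists u => //; split=> //.
  apply: run_stutter => // s' /[dup] /nop /eqP nos /andP[ss' _].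
  by case: (solo s' (leq_trans ts ss')).
have [u tu [equ Ru]] := next t (leqnn t).
have [t_u1 locu memu] : [/\ t <= u.+1,
    loc (R u.+1) p = after_snapshot (prop p) (regs (R t)) & regs (R u.+1) = regs (R t)].
  by rewrite ltnW // (runS equ) Ru /step idle /= eqxx.
case eqa: (after_snapshot (prop p) (regs (R t))) locu => [|x S|w] locu.
- by move: eqa; case: snapshotP.
- have [u' uu' [equ' Ru']] := next u.+1 t_u1.
  have tu' : t <= u'.+1 by apply/leqW/(leq_trans t_u1).
  apply: (IH u'.+1) => [s us||]; first by apply: solo; apply: leq_trans us.
    by rewrite (runS equ') Ru' /step locu /= eqxx.
  rewrite (runS equ') Ru' /step locu memu /=; apply: leq_trans potk.
  apply: solo_pot_decr eqa; rewrite (wf_run _).1; exact: leq_ltn_trans (ltn_ord p).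
by exists u.+1, w.
Qed.

Lemma ob_termination p t : correct sched p ->
  (forall s, t <= s -> sched s = Some p \/ sched s = None) ->
  exists t' w, loc (R t') p = Decided w.
Proof.
move=> cp solo; have [u tu [idle|[w dec]]] := next_idle t cp; last by exists u, w.
by apply: (solo_decides cp _ idle (ltnSn _)) => s us; apply: solo; apply: leq_trans us.
Qed.

(** If the memory equals that of time [t] both when [p] snapshots and when it writes, the write hits
    a register known from the snapshot to differ. *)
Lemma correct_progress p t : correct sched p ->
  (exists t' w, loc (R t') p = Decided w) \/
  (exists2 t', t <= t' & regs (R t') != regs (R t)).
Proof.
move=> cp; have [u tu [idle|[w dec]]] := next_idle t cp; last by left; exists u, w.
have [u1 uu1 [equ1 loc1 _]] := next_step_loc u cp.
have loc1S : loc (R u1.+1) p = after_snapshot (prop p) (regs (R u1)).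
  by rewrite (runS equ1) /step loc1 idle /= eqxx.
case eqa: (after_snapshot (prop p) (regs (R u1))) loc1S => [|x S|w] loc1S.
- by move: eqa; case: snapshotP.
- have [u2 u12 [equ2 loc2 _]] := next_step_loc u1.+1 cp.
  right; have t1 : t <= u1 by apply: leq_trans uu1.
  have [eq1|] := eqVneq (regs (R u1)) (regs (R t)); last by exists u1.
  have [eq2|] := eqVneq (regs (R u2)) (regs (R t)); last first.
    by exists u2 => //; apply: leq_trans t1 (ltnW u12).
  exists u2.+1; first by apply: leqW; apply: leq_trans t1 (ltnW u12).
  rewrite (runS equ2) /step loc2 loc1S /= eq2 -eq1.
  have [|_] := snapshot_changes _ eqa.
    by rewrite (wf_run _).1; apply: leq_ltn_trans (ltn_ord p).
  by apply: contraNneq => <-; rewrite nth_set_nth /= eqxx.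
by left; exists u1.+1, w.
Qed.

Lemma sv_termination v p : (forall i, prop i = v) -> correct sched p ->
  exists t w, loc (R t) p = Decided w.
Proof.
move=> propv cp.
have inv t : sv_inv bot v (R t).
  elim: t => [|t IH].
    split=> [q|i x q|_] //=; first by rewrite mem_nseq !inE => /andP[_ ->].
    by split=> //; rewrite mem_nseq andbC.
  rewrite /=; case: (sched t) => [i|//].
  by rewrite propv; apply: sv_inv_step IH; apply: wf_run.
have mono t t' : t <= t' -> sv_pot bot v (R t') <= sv_pot bot v (R t) /\
    (regs (R t') != regs (R t) -> sv_pot bot v (R t') < sv_pot bot v (R t)).
  elim: t' => [|t' IH]; first by rewrite leqn0 => /eqP->; rewrite eqxx.
  rewrite leq_eqVlt => /orP[/eqP->|/IH[le_pot lt_pot]]; first by rewrite eqxx.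
  rewrite /=; case: (sched t') => [i|//]; rewrite propv.
  have [le_pot' lt_pot'] := sv_pot_step i (wf_run t') (inv t').
  split=> [|neq]; first exact: leq_trans le_pot.
  have [eq_t'|/lt_pot] := eqVneq (regs (R t')) (regs (R t)).
    by apply: leq_trans le_pot; apply: lt_pot'; rewrite eq_t'.
  exact: leq_ltn_trans.
(* As long as [p] has not decided, the memory changes again, and each change strictly lowers the
   potential. *)
have [k] := ubnP (sv_pot bot v (R 0)); elim: k 0 => // k IH t; rewrite ltnS => potk.
case: (correct_progress t cp) => // -[t' tt' neq]; apply: (IH t').
by apply: leq_trans potk; have [_] := mono _ _ tt'; apply.
Qed.

End Runs.
End Quads.

Theorem theorem1 (disp : Order.disp_t) (V : orderType disp) (bot : V)
    (bot_least : forall v : V, (bot <= v)%O)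
    (n : nat) (prop : 'I_n -> V) (prop_ok : forall p, prop p != bot)
    (sched : nat -> option 'I_n) :
  (* Validity *)
  (forall t p w, decides_at bot n prop sched t p w -> exists q, prop q = w) /\
  (* Agreement *)
  (forall t t' p p' w w', decides_at bot n prop sched t p w ->
      decides_at bot n prop sched t' p' w' -> w = w') /\
  (* OB-termination *)
  (forall p t0, (forall t, (t0 <= t)%N -> sched t = Some p \/ sched t = None) ->
      correct sched p -> exists t w, decides_at bot n prop sched t p w) /\
  (* SV-termination *)
  ((forall p p', prop p = prop p') ->
      forall p, correct sched p -> exists t w, decides_at bot n prop sched t p w).
Proof.
split; first by move=> t p w; apply: validity.
split; first by move=> t t' p p' w w'; apply: agreement.
split; first by move=> p t0 solo cp; apply: ob_termination cp solo.
by move=> same p; apply: (@sv_termination _ _ _ _ _ _ (prop p)) => i; apply: same.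
Qed.
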